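(* (Nonparametric spectral approximation.) Let $\mathscr{C}$ be the GraField kernel of a graph $\mathcal G$ on $n$ vertices, let $\lambda_k,\phi_k$ denote its eigenvalues and eigenfunctions, satisfying the integral equation $$\int_0^1\big[\mathscr{C}(u,v)-1\big]\phi_k(v)\,dv=\lambda_k\phi_k(u),$$ and let $\eta_1,\dots,\eta_n$ be a quantile-domain basis as described in the context. Consider the projection estimators of the eigenfunctions, $$\phi_k(u)\approx\mathcal P_n\phi_k(u)=\sum_{j=1}^n\theta_{jk}\,\eta_j(u),\qquad 0<u<1,$$ where the $\theta_{jk}$ are unknown coefficients to be estimated. Then the Fourier coefficients $\{\theta_{jk}\}$ of these projection estimators of the GraField eigenfunctions (eigenvalues and eigenvectors) can be obtained by solving the generalized matrix eigenvalue problem $$\mathcal M\,\Theta=S\,\Theta\,\Delta,$$ where $\Theta=(\theta_{jk})$, $\Delta$ is the diagonal matrix of the eigenvalues $\lambda_k$, and $$\mathcal M_{jk}=\Big\langle \eta_j,\int_0^1(\mathscr{C}(\cdot,v)-1)\,\eta_k(v)\,dv\Big\rangle_{L^2[0,1]},\qquad S_{jk}=\langle\eta_j,\eta_k\rangle_{L^2[0,1]}.$$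
   Context: $\mathcal G$ is an undirected, possibly weighted, graph with vertex set $\{1,\dots,n\}$ and symmetric adjacency matrix $A$ with nonnegative entries; every vertex degree $\sum_yA(x,y)$ is positive. Put $N=\sum_{x,y}A(x,y)$, $P(x,y)=A(x,y)/N$ (network probability mass function), $p(x)=\sum_yP(x,y)$ (vertex probability mass function), $F(x)=\sum_{y\le x}p(y)$, and let $Q(u)=\min\{x:F(x)\ge u\}$, $0<u<1$, be the associated (left-continuous) quantile function. The GraField kernel is the piecewise-constant function $\mathscr{C}(u,v)=P(Q(u),Q(v))/\big(p(Q(u))\,p(Q(v))\big)$ for $0<u,v<1$. The eigenpairs $(\lambda_k,\phi_k)$ are those of the canonical (Schmidt) expansion $\mathscr{C}(u,v)=1+\sum_{k=1}^{n-1}\lambda_k\phi_k(u)\phi_k(v)$, with $\{\phi_k\}$ orthonormal in $L^2[0,1]$. Quantile-domain basis: starting from an orthonormal basis $\xi_j$ of $L^2[0,1]$, one evaluates $\xi_j$ at the vertex rank-transforms to get functions $x\mapsto\xi_j(F(x))$ on the vertices. These are taken to be orthogonal with respect to $p$, i.e. $\sum_x\xi_j(F(x))\,\xi_k(F(x))\,p(x)=0$ for $j\neq k$, and to form an orthogonal basis of the Hilbert space of functions on the vertices with inner product $\langle y,z\rangle=\sum_xy(x)z(x)p(x)$. Then $\eta_j(u)=\xi_j(F(Q(u)))$, $0<u<1$, $j=1,\dots,n$. The $\eta_j$ are piecewise-constant left-continuous functions over the grid $0,\,p(1),\,p(1)+p(2),\dots,\sum_{j=1}^np(j)=1$ satisfying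 $\langle\eta_j,\eta_k\rangle_{L^2[0,1]}=0$ for $j\ne k$. The projection estimator $\mathcal P_n\phi_k$ is the approximation of $\phi_k$ by its projection on the span of $\{\eta_1,\dots,\eta_n\}$ (a Rietz–Galerkin style approximation scheme). *)

(* Defs.v *)
From HB Require Import structures.
From mathcomp Require Import all_boot all_order all_algebra.
From mathcomp Require Import all_classical all_reals all_analysis.

Set Implicit Arguments.
Unset Strict Implicit.
Unset Printing Implicit Defensive.
Import Order.TTheory GRing.Theory Num.Theory.
Import numFieldNormedType.Exports.

Local Open Scope classical_set_scope.
Local Open Scope ring_scope.

(** Weighted graphs on the vertices [0, ..., n] (so [n.+1] vertices), given by
    their adjacency matrix; self-loops are allowed. *)

Definition is_graph (R : realType) (n : nat) (A : 'M[R]_n.+1) : Prop :=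
  [/\ A^T = A,
      (forall x y, 0 <= A x y) &
      (forall x, 0 < \sum_y A x y)].

Definition network_pmf (R : realType) (n : nat) (A : 'M[R]_n.+1)
    (x y : 'I_n.+1) : R :=
  A x y / (\sum_a \sum_b A a b).

Definition vertex_pmf (R : realType) (n : nat) (A : 'M[R]_n.+1)
    (x : 'I_n.+1) : R :=
  \sum_y network_pmf A x y.

Definition vertex_cdf (R : realType) (n : nat) (A : 'M[R]_n.+1)
    (x : 'I_n.+1) : R :=
  \sum_(y < n.+1 | (y <= x)%N) vertex_pmf A y.

(** [min {x | u <= F x}]. For [u <= 1] the witness [ord_max] required by
    [arg min] satisfies the condition, since [F ord_max = 1]; for [u > 1] the
    value is irrelevant. *)
Definition quantile (R : realType) (n : nat) (A : 'M[R]_n.+1)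
    (u : R) : 'I_n.+1 :=
  [arg min_(x < ord_max | (u <= vertex_cdf A x)%R) (x : nat)]%N.

Definition graField (R : realType) (n : nat) (A : 'M[R]_n.+1) (u v : R) : R :=
  network_pmf A (quantile A u) (quantile A v) /
    (vertex_pmf A (quantile A u) * vertex_pmf A (quantile A v)).

(** Elements of $L^2[0,1]$ are represented by functions [R -> R], whose values
    outside [[0, 1]] play no role. *)

Definition in_L2 (R : realType) (f : R -> R) : Prop :=
  f \_ `[0, 1] \in Lfun (@lebesgue_measure R) 2%:E.

Definition inner_L2 (R : realType) (f g : R -> R) : R :=
  \int[@lebesgue_measure R]_(u in `[0, 1]) (f u * g u).

Definition orthonormal_L2 (R : realType) (I : eqType) (f : I -> R -> R) : Prop :=
  (forall i, in_L2 (f i)) /\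
  (forall i j, inner_L2 (f i) (f j) = (i == j)%:R).

Definition orthonormal_basis_L2 (R : realType) (xi : nat -> R -> R) : Prop :=
  orthonormal_L2 xi /\
  forall f, in_L2 f ->
    let residual m u := f u - \sum_(j < m) inner_L2 f (xi j) * xi j u in
    (fun m => inner_L2 (residual m) (residual m)) @ \oo --> (0 : R).

Definition graField_operator (R : realType) (n : nat) (A : 'M[R]_n.+1)
    (f : R -> R) (u : R) : R :=
  \int[@lebesgue_measure R]_(v in `[0, 1]) ((graField A u v - 1) * f v).

(** Equations between elements of $L^2$ are understood almost everywhere. *)
Definition integral_equation (R : realType) (n : nat) (A : 'M[R]_n.+1)
    (l : R) (f : R -> R) : Prop :=
  {ae @lebesgue_measure R, forall u, 0 < u < 1 ->
     graField_operator A f u = l * f u}.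

(** The index [k : 'I_n] stands for the number [k + 1] in [1, ..., N - 1],
    where [N = n.+1] is the number of vertices. *)
Definition schmidt_expansion (R : realType) (n : nat) (A : 'M[R]_n.+1)
    (lambda : 'rV[R]_n) (phi : 'I_n -> R -> R) : Prop :=
  orthonormal_L2 phi /\
  {ae (@lebesgue_measure R \x @lebesgue_measure R)%E, forall z : R * R,
     0 < z.1 < 1 -> 0 < z.2 < 1 ->
     graField A z.1 z.2 = 1 + \sum_k lambda 0 k * phi k z.1 * phi k z.2}.

(** The first [n.+1] functions of the orthonormal basis [xi], evaluated at the
    rank-transforms, form an orthogonal basis of the functions on the vertices
    with inner product weighted by [vertex_pmf]. *)
Definition vertex_basis (R : realType) (n : nat) (A : 'M[R]_n.+1)
    (xi : nat -> R -> R) : Prop :=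
  (forall j k : 'I_n.+1, j != k ->
     \sum_x xi j (vertex_cdf A x) * xi k (vertex_cdf A x) * vertex_pmf A x = 0)
  /\
  basis_of {: {ffun 'I_n.+1 -> R^o}}
    [seq [ffun x => xi j (vertex_cdf A x) : R^o] | j : 'I_n.+1].

Definition quantile_basis (R : realType) (n : nat) (A : 'M[R]_n.+1)
    (xi : nat -> R -> R) (j : 'I_n.+1) (u : R) : R :=
  xi j (vertex_cdf A (quantile A u)).

Definition lincomb (R : realType) (n : nat) (eta : 'I_n -> R -> R)
    (c : 'cV[R]_n) (u : R) : R :=
  \sum_j c j 0 * eta j u.

(** [lincomb eta c] is the orthogonal projection of [f] on the span of [eta]. *)
Definition is_projection (R : realType) (n : nat) (eta : 'I_n -> R -> R)
    (f : R -> R) (c : 'cV[R]_n) : Prop :=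
  forall j, inner_L2 (fun u => f u - lincomb eta c u) (eta j) = 0.

Definition galerkin_mx (R : realType) (n : nat) (A : 'M[R]_n.+1)
    (eta : 'I_n.+1 -> R -> R) : 'M[R]_n.+1 :=
  \matrix_(j, k) inner_L2 (eta j) (graField_operator A (eta k)).

Definition gram_mx (R : realType) (n : nat) (eta : 'I_n -> R -> R) : 'M[R]_n :=
  \matrix_(j, k) inner_L2 (eta j) (eta k).

(* Main.v *)
Require Import Defs.
From mathcomp Require Import all_boot all_order all_algebra.
From mathcomp Require Import all_classical all_reals all_analysis.
From mathcomp Require Import measurable_realfun.
From mathcomp Require Import ring lra.
(** Everything reduces to linear algebra on functions of the vertices. The
    quantile function Q is constant, equal to x, on the interval
    ]F x - p x, F x], of length p x, and these cells tile ]0, 1]. The basis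
    functions, their combinations and the images of the integral operator are
    therefore of the form g o Q with g a column vector indexed by the vertices.
    Write D for the diagonal matrix of the weights p x, K for the kernel minus
    one, as a matrix on the vertices, E for the matrix of the values xi j (F x),
    and m f for the vector of averages of f on the cells. Then the operator
    sends any integrable f to (K D (m f)) o Q (graField_operatorE), and the
    matrices of the problem factor as M = E^T D K D E and S = E^T D E
    (galerkin_mxE, gram_mxE). Since the vertex functions xi j o F form a basis,
    E is invertible, and so is the common factor E^T D: hence
    M T = S T diag(d) says exactly that each column t of T makes E t an
    eigenvector of K D (galerkin_eigenP). An almost everywhere equation between
    step functions is an equation between vectors, because every cell has
    positive length, so this is also the integral equation for the combination
    with coefficients t (integral_equation_step).

    The projection of f on the span of the basis has coefficients
    E^-1 (m f) (is_projectionP). Averaging the integral equation of an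
    eigenfunction phi over the cells gives K D (m phi) = lambda (m phi)
    (integral_equation_avg), so the projection coefficients solve the matrix
    problem.

    For the converse, averaging the Schmidt expansion over the products of two
    cells gives K = sum_i lambda_i a_i a_i^T with a_i = m phi_i
    (kernel_mx_schmidt). If K D g = d g with d nonzero, then g is the sum of the
    a_i with coefficients lambda_i <a_i, g> / d, and the symmetry of K D for the
    weighted inner product gives lambda_i <a_i, g> = d <a_i, g>; so only the
    a_i with lambda_i = d occur (eigenvector_decomposition). *)

Set Implicit Arguments.
Unset Strict Implicit.
Unset Printing Implicit Defensive.
Import Order.TTheory GRing.Theory Num.Theory.
Import numFieldNormedType.Exports.
Local Open Scope classical_set_scope.
Local Open Scope ring_scope.

(** * Integration *)

Section Integration.
Context d (T : measurableType d) (R : realType) (mu : {measure set T -> \bar R}).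

Lemma Rintegral_lincomb (I : Type) (r : seq I) (D : set T) (c : I -> R)
    (f : I -> T -> R) : measurable D ->
  (forall i, mu.-integrable D (EFin \o f i)) ->
  mu.-integrable D (EFin \o (fun u => \sum_(i <- r) c i * f i u)) /\
  \int[mu]_(u in D) (\sum_(i <- r) c i * f i u) =
    \sum_(i <- r) c i * \int[mu]_(u in D) f i u.
Proof.
move=> mD fint; elim: r => [|i r [IHint IH]].
  split; first by under eq_fun do rewrite big_nil; exact: integrable0.
  rewrite big_nil; under eq_Rintegral do rewrite big_nil.
  by rewrite Rintegral_cst// mul0r.
have cfint : mu.-integrable D (EFin \o (fun u => c i * f i u)).
  by apply: (eq_integrable mD _ _ _ (integrableZl mD (c i) (fint i))).
split.
  apply: (eq_integrable mD _ _ _ (integrableD mD cfint IHint)) => // u _ /=.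
  by rewrite big_cons EFinD.
rewrite big_cons; under eq_Rintegral do rewrite big_cons.
by rewrite RintegralD// IH RintegralZl.
Qed.

Lemma ae_eq_Rintegral (D : set T) (f g : T -> R) : measurable D ->
  mu.-integrable D (EFin \o f) -> mu.-integrable D (EFin \o g) ->
  {ae mu, forall u, D u -> f u = g u} ->
  \int[mu]_(u in D) f u = \int[mu]_(u in D) g u.
Proof.
move=> mD fint gint fg; congr fine; apply: ae_eq_integral => //.
- exact: (measurable_int mu).
- exact: (measurable_int mu).
- by apply: filterS fg => u /[apply] /= ->.
Qed.

End Integration.

(** On a set of finite measure, [|f|] is dominated by [1 + f ^ 2]. *)
Lemma in_L2_integrable (R : realType) (f : R -> R) :
  in_L2 f -> (@lebesgue_measure R).-integrable `]0, 1] (EFin \o f).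
Proof.
move=> fL2; apply: (@integrableS _ _ _ (@lebesgue_measure R) `[0, 1]) => //.
  exact: subset_itv_oc_cc.
apply/(@integrable_mkcond _ _ _ (@lebesgue_measure R)) => //; rewrite restrict_EFin.
have sq := Lfun2_integrable_sqr fL2.
have bound := integrableD measurableT (@integrable_indic_itv R 0 1 true false) sq.
apply: (le_integrable measurableT _ _ bound) => //.
  move: fL2; rewrite /in_L2 inE => /andP[]; rewrite inE/= => mf _.
  exact/measurable_EFinP.
move=> u _.
rewrite -[leLHS]/(`|(f \_ `[0, 1]) u|%:E).
rewrite -[leRHS]/(`|\1_`[0, 1] u + (f \_ `[0, 1]) u ^+ 2|%:E) lee_fin patchE indicE.
case: ifPn; last by rewrite normr0 normr_ge0.
(* t <= 1 + t ^ 2 comes from (t - 1) ^ 2 >= 0 and t >= 0, with t = |f u| *)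
move=> _; rewrite mulr1n [leRHS]ger0_norm ?addr_ge0 ?sqr_ge0//.
have : 0 <= (`|f u| - 1) ^+ 2 := sqr_ge0 _.
have : 0 <= `|f u| := normr_ge0 _.
rewrite -[f u ^+ 2]real_normK ?num_real//; nra.
Qed.


(** The product measure of a null set is the integral of the measures of its
    sections, so almost all sections are null. This replaces Fubini's theorem
    when a two-variable equation is integrated one variable at a time. *)
Lemma ae_prod_section d1 d2 (T1 : measurableType d1) (T2 : measurableType d2)
    (R : realType) (m1 : {measure set T1 -> \bar R})
    (m2 : {sigma_finite_measure set T2 -> \bar R}) (P : T1 * T2 -> Prop) :
  {ae (m1 \x m2)%E, forall z, P z} ->
  {ae m1, forall x, {ae m2, forall y, P (x, y)}}.
Proof.
move=> [N [mN N0 PN]].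
have /= sec0 : ae_eq m1 setT (m2 \o xsection N) (cst 0%E).
  apply/ae_eq_integral_abs => //; first exact: measurable_fun_xsection.
  by under eq_integral do rewrite gee0_abs//.
apply: filterS sec0 => x /(_ I) /= sec0.
exists (xsection N x); split => //; first exact: measurable_xsection.
by move=> y /= nP; rewrite /xsection /= inE; apply: PN.
Qed.

(** * Matrices *)

Lemma mx_entry (R : pzSemiRingType) (m n : nat) (M : 'M[R]_(m, n)) i j :
  M i j = (delta_mx 0 i *m M *m delta_mx j 0 : 'M[R]_1) 0 0.
Proof. by rewrite -rowE -colE !mxE. Qed.

(** For nonzero [d], [g] is [d^-1] times [M W g], hence a combination of the
    [a i] with coefficients proportional to [l i * <a i, g>], where
    [<a, g> = a^T W g]. As [M W] is self-adjoint for this form,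
    [l i * <a i, g> = d * <a i, g>], so a coefficient can only be nonzero when
    [l i = d]. *)
Lemma eigenvector_decomposition (K : fieldType) (n m : nat) (M W : 'M[K]_n)
    (l : 'I_m -> K) (a : 'I_m -> 'cV[K]_n) (d : K) (g : 'cV[K]_n) :
    W^T = W -> M = \sum_i l i *: (a i *m (a i)^T) ->
    (forall i, M *m W *m a i = l i *: a i) ->
    d != 0 -> M *m W *m g = d *: g ->
  exists c : 'cV[K]_m,
    g = \sum_i c i 0 *: a i /\ forall i, c i 0 != 0 -> l i = d.
Proof.
move=> Wsym ME Ma d0 Mg.
have Msym : M^T = M.
  rewrite ME raddf_sum; apply: eq_bigr => i _.
  by rewrite /= linearZ/= trmx_mul trmxK.
pose s i := ((a i)^T *m W *m g) 0 0.
have sE i : (a i)^T *m W *m g = (s i)%:M by rewrite [LHS]mx11_scalar.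
exists (\col_i (d^-1 * l i * s i)); split.
  rewrite -[LHS]scale1r -(mulVf d0) -scalerA -Mg ME.
  rewrite !mulmx_suml scaler_sumr; apply: eq_bigr => i _.
  by rewrite mxE -!scalemxAl -!mulmxA (mulmxA _ W) sE mul_mx_scalar !scalerA.
move=> i; rewrite mxE; apply: contraNeq => ld.
suff /eqP : l i * s i = d * s i.
  rewrite -subr_eq0 -mulrBl mulf_eq0 subr_eq0 (negPf ld)/= => /eqP ->.
  by rewrite mulr0.
(* self-adjointness of M W, read on the pair (a i, g) *)
have /matrixP/(_ 0 0) :
    (M *m W *m a i)^T *m W *m g = (a i)^T *m W *m (M *m W *m g).
  by rewrite !trmx_mul Msym Wsym !mulmxA.
by rewrite Ma Mg linearZ/= -!scalemxAl -scalemxAr sE !mxE mulr1n.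
Qed.

(** * Cells of the quantile function *)

Section Graph.
Context {R : realType} {n : nat} (A : 'M[R]_n.+1).
Notation mu := (@lebesgue_measure R).
Notation p := (vertex_pmf A).
Notation F := (vertex_cdf A).
Notation Q := (quantile A).

Definition cell (x : 'I_n.+1) : set R := `](F x - p x), F x].

Definition cell_avg (f : R -> R) : 'cV[R]_n.+1 :=
  \col_x (\int[mu]_(u in cell x) f u / p x).

(** The identification of functions on the vertices with functions on ]0, 1] that
    are constant on the cells; [cell_avg] undoes it. *)
Definition step (g : 'cV[R]_n.+1) (u : R) : R := g (Q u) 0.

Definition weight_mx : 'M[R]_n.+1 := diag_mx (\row_x p x).

(** The values on pairs of cells of the kernel of the integral operator. *)
Definition kernel_mx : 'M[R]_n.+1 :=
  \matrix_(x, y) (network_pmf A x y / (p x * p y) - 1).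

Lemma measurable_unit_interval :
  measurable (`]0, 1] : set (measurableTypeR R)).
Proof. exact: measurable_itv. Qed.

Lemma measurable_cell x : measurable (cell x : set (measurableTypeR R)).
Proof. exact: measurable_itv. Qed.

Context (graphA : is_graph A).

Lemma vertex_pmf_gt0 x : 0 < p x.
Proof.
have [_ A_ge0 deg_gt0] := graphA.
rewrite /vertex_pmf -mulr_suml divr_gt0//.
rewrite (bigD1 ord0)//= ltr_pwDl// sumr_ge0// => a _.
exact: sumr_ge0.
Qed.

Lemma sum_vertex_pmf : \sum_x p x = 1.
Proof.
have [_ A_ge0 deg_gt0] := graphA.
under eq_bigr do rewrite /vertex_pmf -mulr_suml.
rewrite -mulr_suml divff// gt_eqF// (bigD1 ord0)//= ltr_pwDl//.
by apply: sumr_ge0 => a _; exact: sumr_ge0.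
Qed.

Lemma vertex_cdf_subr x : F x - p x = \sum_(y < n.+1 | (y < x)%N) p y.
Proof.
rewrite /vertex_cdf (bigD1 x)//= addrAC subrr add0r; apply: eq_bigl => y.
by rewrite ltn_neqAle andbC.
Qed.

Lemma vertex_cdf_le1 x : F x <= 1.
Proof.
rewrite -sum_vertex_pmf /vertex_cdf [leRHS](bigID (fun y : 'I_n.+1 => (y <= x)%N))/=.
by rewrite lerDl sumr_ge0// => y _; rewrite ltW ?vertex_pmf_gt0.
Qed.

Lemma vertex_cdf_le_subr (x y : 'I_n.+1) : (x < y)%N -> F x <= F y - p y.
Proof.
move=> xy; rewrite vertex_cdf_subr.
rewrite [leRHS](bigID (fun z : 'I_n.+1 => (z <= x)%N))/=.
rewrite [X in _ <= X + _](_ : _ = F x); last first.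
  apply: eq_bigl => z; case: (leqP z x); rewrite ?andbF// andbT => zx.
  by rewrite (leq_ltn_trans zx).
by rewrite lerDl sumr_ge0// => z _; rewrite ltW ?vertex_pmf_gt0.
Qed.

Lemma vertex_cdf_subr_ge0 x : 0 <= F x - p x.
Proof.
by rewrite vertex_cdf_subr sumr_ge0// => y _; rewrite ltW ?vertex_pmf_gt0.
Qed.

Lemma quantileP u : u <= 1 ->
  u <= F (Q u) /\ forall y : 'I_n.+1, u <= F y -> (Q u <= y)%N.
Proof.
move=> u1; rewrite /quantile; case: arg_minnP => //.
rewrite /vertex_cdf (eq_bigl xpredT) ?sum_vertex_pmf// => y.
by rewrite -ltnS ltn_ord.
Qed.

(** The left-continuous choice of [Q], with [u <= F x] in its definition, is what
    makes the cells open on the left and closed on the right. *)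
Lemma mem_cell u x : u \in `]0, 1] -> (u \in cell x) = (x == Q u).
Proof.
rewrite in_itv/= => /andP[u0 u1]; have [uFQ Qmin] := quantileP u1.
apply/idP/eqP => [|->]; rewrite /cell inE/= in_itv/=.
  move=> /andP[xu /Qmin Qx]; apply/val_inj/eqP; rewrite eqn_leq Qx andbT.
  rewrite leqNgt; apply/negP => /vertex_cdf_le_subr FQx.
  by have := lt_le_trans (le_lt_trans FQx xu) uFQ; rewrite ltxx.
rewrite uFQ andbT ltNge; apply/negP => uQ.
case Qu : (Q u : nat) => [|q].
  (* below the first vertex there is no mass, and u is positive *)
  by move: uQ; rewrite vertex_cdf_subr Qu big1// leNgt u0.
(* otherwise u is at most the cdf of the preceding vertex q, against the
   minimality of Q u *)
have qn : (q < n.+1)%N by rewrite ltnW// -Qu ltn_ord.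
have /Qmin : u <= F (Ordinal qn).
  by rewrite (le_trans uQ)// vertex_cdf_subr Qu.
by rewrite Qu /= ltnn.
Qed.

Lemma cell_sub x : cell x `<=` `]0, 1].
Proof.
move=> u; rewrite /cell/= !in_itv/= => /andP[xu ux].
by rewrite (le_lt_trans (vertex_cdf_subr_ge0 x) xu) (le_trans ux (vertex_cdf_le1 x)).
Qed.

Lemma cell_quantile x u : u \in cell x -> Q u = x.
Proof.
move=> ux; apply/esym/eqP; rewrite -mem_cell//.
by move: ux; rewrite inE => /cell_sub.
Qed.

Lemma measure_cell x : mu (cell x) = (p x)%:E.
Proof.
rewrite /cell lebesgue_measure_itv/= lte_fin ltrBlDr ltrDl vertex_pmf_gt0.
by rewrite -EFinB opprB addrCA subrr addr0.
Qed.

Lemma integrable_cell f x : mu.-integrable `]0, 1] (EFin \o f) ->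
  mu.-integrable (cell x) (EFin \o f).
Proof. by apply: integrableS => //; [exact: measurable_cell|exact: cell_sub]. Qed.

(** * Step functions and cell averages *)

Lemma step_mul (g : 'I_n.+1 -> R) (f : R -> R) u : u \in `]0, 1] ->
  g (Q u) * f u = \sum_x g x * (f \_ (cell x)) u.
Proof.
move=> u01; rewrite (bigD1 (Q u))//= patchE mem_cell// eqxx.
rewrite big1 ?addr0// => x xQ.
by rewrite patchE mem_cell// (negPf xQ) mulr0.
Qed.

(** The endpoint 0, which lies in no cell, is a null set. *)
Lemma Rintegral_step (g : 'I_n.+1 -> R) (f : R -> R) :
    mu.-integrable `]0, 1] (EFin \o f) ->
  mu.-integrable `]0, 1] (EFin \o (fun u => g (Q u) * f u)) /\
  \int[mu]_(u in `[0, 1]) (g (Q u) * f u) =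
    \sum_x g x * \int[mu]_(u in cell x) f u.
Proof.
move=> fint.
have fcell x : mu.-integrable `]0, 1] (EFin \o (f \_ (cell x))).
  rewrite -restrict_EFin; apply/integrable_restrict => //.
    exact: measurable_cell.
  by rewrite setIidr; [exact: integrable_cell|exact: cell_sub].
have [sint sE] := Rintegral_lincomb (index_enum _) g measurable_unit_interval fcell.
have gfint : mu.-integrable `]0, 1] (EFin \o (fun u => g (Q u) * f u)).
  apply: (eq_integrable measurable_unit_interval _ _ _ sint) => // u.
  rewrite inE => u01 /=.
  by rewrite step_mul.
split=> //; rewrite -Rintegral_itv_obnd_cbnd//.
transitivity (\int[mu]_(u in `]0, 1]) \sum_x g x * (f \_ (cell x)) u).
  by apply: eq_Rintegral => u; rewrite inE => u01; rewrite step_mul.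
rewrite sE; apply: eq_bigr => x _; congr (_ * _).
rewrite -Rintegral_mkcondr setIidr//; exact: cell_sub.
Qed.

Lemma integrable_cst01 (c : R) : mu.-integrable `]0, 1] (EFin \o (fun=> c)).
Proof.
apply: measurable_bounded_integrable => //.
  by rewrite /= lebesgue_measure_itv/= lte_fin ltr01 -EFinB ltry.
exact: bounded_cst.
Qed.

Lemma integrable_step g : mu.-integrable `]0, 1] (EFin \o step g).
Proof.
have [+ _] := Rintegral_step (fun x => g x 0) (integrable_cst01 1).
by apply: eq_integrable => // u _ /=; rewrite mulr1.
Qed.

Lemma Rintegral_cell f x : \int[mu]_(u in cell x) f u = p x * cell_avg f x 0.
Proof. by rewrite mxE mulrC divfK// gt_eqF// vertex_pmf_gt0. Qed.

Lemma cell_avg_step g : cell_avg (step g) = g.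
Proof.
apply/colP => x; rewrite mxE.
under eq_Rintegral => u ux do rewrite /step (cell_quantile ux).
rewrite Rintegral_cst; last exact: measurable_cell.
rewrite (_ : fine _ = p x) ?mulfK ?gt_eqF ?vertex_pmf_gt0//.
by rewrite -[RHS]/(fine (p x)%:E) -measure_cell.
Qed.

(** The last cell contains 1, where [f] and [g] may differ, but this endpoint is a
    null set. *)
Lemma cell_avg_ae f g : mu.-integrable `]0, 1] (EFin \o f) ->
    mu.-integrable `]0, 1] (EFin \o g) ->
  {ae mu, forall u, 0 < u < 1 -> f u = g u} -> cell_avg f = cell_avg g.
Proof.
move=> fint gint fg; apply/colP => x; rewrite !mxE; congr (_ / _).
apply: ae_eq_Rintegral.
- exact: measurable_cell.
- exact: integrable_cell.
- exact: integrable_cell.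
- have ne1 : {ae mu, forall u, u != 1}.
    exists [set 1]; split => //; first exact: lebesgue_measure_set1.
    by move=> u /= /negP; rewrite negbK => /eqP.
  apply: (@filterS2 _ _ (ae_filter_ringOfSetsType mu) _ _ _ _ fg ne1).
  move=> u fgu u1 /cell_sub/=; rewrite in_itv/= => /andP[u0 ule].
  by apply: fgu; rewrite u0 lt_neqAle u1.
Qed.

Lemma cell_avg_sum (I : Type) (r : seq I) (c : I -> R) (f : I -> R -> R) :
    (forall i, mu.-integrable `]0, 1] (EFin \o f i)) ->
  cell_avg (fun u => \sum_(i <- r) c i * f i u) =
    \sum_(i <- r) c i *: cell_avg (f i).
Proof.
move=> fint; apply/colP => x; rewrite summxE mxE.
have [_ ->] := Rintegral_lincomb r c (measurable_cell x)
  (fun i => integrable_cell x (fint i)).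
by rewrite mulr_suml; apply: eq_bigr => i _; rewrite !mxE mulrA.
Qed.

Lemma cell_avgB f g : mu.-integrable `]0, 1] (EFin \o f) ->
    mu.-integrable `]0, 1] (EFin \o g) ->
  cell_avg (fun u => f u - g u) = cell_avg f - cell_avg g.
Proof.
move=> fint gint; apply/colP => x; rewrite !mxE -mulrBl RintegralB//.
- exact: measurable_cell.
- exact: integrable_cell.
- exact: integrable_cell.
Qed.

Lemma inner_L2_step g f : mu.-integrable `]0, 1] (EFin \o f) ->
  inner_L2 (step g) f = (g^T *m weight_mx *m cell_avg f) 0 0.
Proof.
move=> fint; rewrite /inner_L2 /step.
have [_ ->] := Rintegral_step (fun x => g x 0) fint.
rewrite mul_mx_diag mxE; apply: eq_bigr => x _.
by rewrite Rintegral_cell !mxE mulrA.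
Qed.

(** * The integral operator on step functions *)

(** For fixed [u] the kernel is a step function of its second variable, so the
    operator only sees the cell averages of [f]; and it depends on [u] only
    through [Q u]. *)
Lemma graField_operatorE f : mu.-integrable `]0, 1] (EFin \o f) ->
  graField_operator A f = step (kernel_mx *m weight_mx *m cell_avg f).
Proof.
move=> fint; apply/funext => u; rewrite /graField_operator /graField.
have [_ E] := Rintegral_step (fun y => kernel_mx (Q u) y) fint.
rewrite /step mul_mx_diag mxE.
transitivity (\int[mu]_(v in `[0, 1]) (kernel_mx (Q u) (Q v) * f v)).
  by apply: eq_Rintegral => v _; rewrite mxE.
by rewrite E; apply: eq_bigr => y _; rewrite Rintegral_cell !mxE mulrA.
Qed.

Lemma integral_equation_avg l f : mu.-integrable `]0, 1] (EFin \o f) ->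
    integral_equation A l f ->
  kernel_mx *m weight_mx *m cell_avg f = l *: cell_avg f.
Proof.
move=> fint; rewrite /integral_equation graField_operatorE// => eqf.
have lint : mu.-integrable `]0, 1] (EFin \o (fun u => l * f u)).
  by apply: (eq_integrable _ _ _ _ (integrableZl _ l fint)).
rewrite -[LHS]cell_avg_step (cell_avg_ae (integrable_step _) lint eqf).
apply/colP => x; rewrite !mxE RintegralZl ?mulrA//; first exact: measurable_cell.
exact: integrable_cell.
Qed.

(** Equality almost everywhere of step functions gives equality of their cell
    averages, that is, equality at every vertex. *)
Lemma integral_equation_step l g :
  integral_equation A l (step g) <-> kernel_mx *m weight_mx *m g = l *: g.
Proof.
split=> [/(integral_equation_avg (integrable_step g))|eqg].
  by rewrite cell_avg_step.
apply: aeW => u _.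
by rewrite graField_operatorE ?cell_avg_step ?eqg /step ?mxE//; exact: integrable_step.
Qed.

(** The expansion is averaged over [v] in the cell of [y] for almost every fixed
    [u], which leaves an almost everywhere equation in [u] to be averaged over the
    cell of [x]. *)
Lemma kernel_mx_schmidt (m : nat) (lambda : 'rV[R]_m) (phi : 'I_m -> R -> R) :
    (forall k, mu.-integrable `]0, 1] (EFin \o phi k)) ->
    {ae (mu \x mu)%E, forall z : R * R, 0 < z.1 < 1 -> 0 < z.2 < 1 ->
      graField A z.1 z.2 = 1 + \sum_k lambda 0 k * phi k z.1 * phi k z.2} ->
  kernel_mx = \sum_k lambda 0 k *: (cell_avg (phi k) *m (cell_avg (phi k))^T).
Proof.
move=> phint /ae_prod_section expand.
apply/matrixP => x y; rewrite summxE.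
have rowE : {ae mu, forall u, 0 < u < 1 -> step (col y kernel_mx) u =
    \sum_k (lambda 0 k * cell_avg (phi k) y 0) * phi k u}.
  apply: filterS expand => u expand u01.
  have : cell_avg (step (row (Q u) kernel_mx)^T) =
      cell_avg (fun v => \sum_k (lambda 0 k * phi k u) * phi k v).
    apply: cell_avg_ae; first exact: integrable_step.
      by have [] := Rintegral_lincomb (index_enum _)
        (fun k => lambda 0 k * phi k u) measurable_unit_interval phint.
    apply: filterS expand => v /(_ u01) /[apply] /= E.
    by rewrite /step !mxE -/(graField A u v) E addrAC subrr add0r.
  rewrite cell_avg_step cell_avg_sum// => /colP/(_ y).
  rewrite summxE /step !mxE => ->; apply: eq_bigr => k _.
  by rewrite mxE mulrAC.
have : cell_avg (step (col y kernel_mx)) =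
    cell_avg (fun u => \sum_k (lambda 0 k * cell_avg (phi k) y 0) * phi k u).
  apply: cell_avg_ae rowE; first exact: integrable_step.
  by have [] := Rintegral_lincomb (index_enum _)
    (fun k => lambda 0 k * cell_avg (phi k) y 0) measurable_unit_interval phint.
rewrite cell_avg_step cell_avg_sum// => /colP/(_ x).
rewrite summxE [LHS]mxE => ->; apply: eq_bigr => k _.
by move: (cell_avg (phi k)) => a; rewrite !mxE big_ord1 !mxE; ring.
Qed.

(** * The quantile-domain basis *)

Section Basis.
Context (xi : nat -> R -> R) (basis_vertex : vertex_basis A xi).

Definition basis_mx : 'M[R]_n.+1 := \matrix_(x, j) xi j (F x).

(** Expanding the indicator of each vertex on the basis of vertex functions
    provides a right inverse. *)
Lemma basis_mx_unit : basis_mx \in unitmx.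
Proof.
have [_ /andP[/eqP spanE _]] := basis_vertex.
suff colE (g : 'cV[R]_n.+1) : exists c, g = basis_mx *m c.
  have [c cE] := choice (fun y => colE (col y 1%:M)).
  apply: (proj1 (@mulmx1_unit _ _ _ (\matrix_(j, y) c y j 0) _)).
  apply/matrixP => x y; have /colP/(_ x) := cE y.
  by rewrite !mxE => ->; apply: eq_bigr => j _; rewrite !mxE.
have : [ffun x => g x 0 : R^o] \in fullv by exact: memvf.
rewrite -spanE span_def big_image/= => /memv_sumP[v vE gE].
have vscale j : exists a, v j = a *: [ffun x => xi j (F x) : R^o].
  by have /vlineP := vE j isT.
have [a aE] := choice vscale.
exists (\col_j a j); apply/colP => x.
have /ffunP/(_ x) := gE; rewrite ffunE sum_ffunE mxE => ->.
by apply: eq_bigr => j _; rewrite aE !ffunE !mxE mulrC.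
Qed.

Lemma quantile_basisE j : quantile_basis A xi j = step (col j basis_mx).
Proof. by apply/funext => u; rewrite /step !mxE. Qed.

Lemma lincomb_step c :
  lincomb (quantile_basis A xi) c = step (basis_mx *m c).
Proof.
apply/funext => u; rewrite /step mxE; apply: eq_bigr => j _.
by rewrite mxE mulrC.
Qed.

Lemma gram_mxE :
  gram_mx (quantile_basis A xi) = basis_mx^T *m weight_mx *m basis_mx.
Proof.
apply/matrixP => j k; rewrite mxE !quantile_basisE inner_L2_step; last first.
  exact: integrable_step.
by rewrite cell_avg_step tr_col [RHS]mx_entry rowE colE !mulmxA.
Qed.

Lemma galerkin_mxE : galerkin_mx A (quantile_basis A xi) =
  basis_mx^T *m weight_mx *m (kernel_mx *m weight_mx *m basis_mx).
Proof.
apply/matrixP => j k; rewrite mxE !quantile_basisE graField_operatorE; last first.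
  exact: integrable_step.
rewrite inner_L2_step; last exact: integrable_step.
by rewrite !cell_avg_step tr_col [RHS]mx_entry rowE colE !mulmxA.
Qed.

Lemma weight_mx_unit : weight_mx \in unitmx.
Proof.
rewrite unitmxE det_diag unitfE; apply/prodf_neq0 => x _.
by rewrite mxE gt_eqF// vertex_pmf_gt0.
Qed.

(** Testing a step function against all basis functions in [L^2] amounts to
    multiplying its vector of values by this matrix. *)
Lemma mulmx_test_inj m :
  injective (@mulmx R _ _ m (basis_mx^T *m weight_mx)).
Proof.
apply: can_inj (mulKmx _).
by rewrite unitmx_mul unitmx_tr basis_mx_unit weight_mx_unit.
Qed.

(** The residual is orthogonal to every basis function, hence to every step
    function, exactly when its cell averages vanish. *)
Lemma is_projectionP f c : mu.-integrable `]0, 1] (EFin \o f) ->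
  is_projection (quantile_basis A xi) f c <-> basis_mx *m c = cell_avg f.
Proof.
move=> fint.
have sint := integrable_step (basis_mx *m c).
have residE j : inner_L2 (fun u => f u - lincomb (quantile_basis A xi) c u)
    (quantile_basis A xi j) =
  (basis_mx^T *m weight_mx *m (cell_avg f - basis_mx *m c)) j 0.
  rewrite lincomb_step quantile_basisE /inner_L2.
  under eq_Rintegral do rewrite mulrC.
  rewrite -/(inner_L2 _ _) inner_L2_step.
    by rewrite cell_avgB// cell_avg_step tr_col -!row_mul mxE.
  exact: (integrableB measurable_unit_interval fint sint).
split=> [proj | Ec j]; last by rewrite residE Ec subrr mulmx0 mxE.
apply/esym/eqP; rewrite -subr_eq0; apply/eqP/(@mulmx_test_inj 1).
by rewrite mulmx0; apply/colP => j; rewrite -residE proj mxE.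
Qed.

(** The factor [E^T D] shared by both sides of the matrix equation can be
    cancelled, and the rest is read column by column. *)
Lemma galerkin_eigenP m (T : 'M[R]_(n.+1, m)) (d : 'rV[R]_m) :
  galerkin_mx A (quantile_basis A xi) *m T =
    gram_mx (quantile_basis A xi) *m T *m diag_mx d <->
  forall k, kernel_mx *m weight_mx *m (basis_mx *m col k T) =
    d 0 k *: (basis_mx *m col k T).
Proof.
have colE' k : col k (basis_mx *m T *m diag_mx d) = d 0 k *: (basis_mx *m col k T).
  by apply/colP => x; rewrite mul_mx_diag !mxE mulrC; congr (_ * _);
    apply: eq_bigr => j _; rewrite !mxE.
have colK k : col k (kernel_mx *m weight_mx *m basis_mx *m T) =
    kernel_mx *m weight_mx *m (basis_mx *m col k T).
  by rewrite !colE !mulmxA.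
rewrite galerkin_mxE gram_mxE -2!(mulmxA (basis_mx^T *m weight_mx)).
rewrite -(mulmxA (basis_mx^T *m weight_mx)).
split=> [/mulmx_test_inj eqT k | eqT]; first by rewrite -colK eqT colE'.
congr (_ *m _); apply/matrixP => x k.
by have := eqT k; rewrite -colK -colE' => /colP/(_ x); rewrite !mxE.
Qed.

End Basis.
End Graph.

(** * Spectral approximation *)

Theorem theorem4 (R : realType) (n : nat) (A : 'M[R]_n.+1)
    (lambda : 'rV[R]_n) (phi : 'I_n -> R -> R) (xi : nat -> R -> R)
    (graphA : is_graph A)
    (schmidt : schmidt_expansion A lambda phi)
    (eigen : forall k : 'I_n, integral_equation A (lambda 0 k) (phi k))
    (basis_xi : orthonormal_basis_L2 xi)
    (basis_vertex : vertex_basis A xi) :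
  let eta := quantile_basis A xi in
  let M := galerkin_mx A eta in
  let S := gram_mx eta in
  exists Theta : 'M[R]_(n.+1, n),
    (* the columns of Theta are the coefficients of the projections of phi *)
    (forall (k : 'I_n) (c : 'cV[R]_n.+1),
       is_projection eta (phi k) c <-> c = col k Theta) /\
    M *m Theta = S *m Theta *m diag_mx lambda /\
    (* conversely, the solutions of the matrix problem give eigenpairs of the
       integral equation, and those with a nonzero eigenvalue are combinations of
       columns of Theta having that same eigenvalue *)
    (forall (m : nat) (T : 'M[R]_(n.+1, m)) (d : 'rV[R]_m),
       (M *m T = S *m T *m diag_mx d <->
        forall k : 'I_m, integral_equation A (d 0 k) (lincomb eta (col k T))) /\
       (M *m T = S *m T *m diag_mx d ->
        forall k : 'I_m, d 0 k != 0 ->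
        exists c : 'cV[R]_n,
          col k T = Theta *m c /\
          forall i : 'I_n, c i 0 != 0 -> lambda 0 i = d 0 k)).
Proof.
move=> eta M S; have [[phi_L2 _] expand] := schmidt.
have phint k := in_L2_integrable (phi_L2 k).
pose E := basis_mx A xi; have Eunit : E \in unitmx := basis_mx_unit basis_vertex.
pose a k := cell_avg A (phi k).
pose Theta := invmx E *m \matrix_(x, k) a k x 0.
have colTheta k : E *m col k Theta = a k.
  by rewrite colE !mulmxA mulmxV// mul1mx -colE; apply/colP => x; rewrite !mxE.
have eigen_a k : kernel_mx A *m weight_mx A *m a k = lambda 0 k *: a k.
  exact: integral_equation_avg.
exists Theta; split; last split.
- move=> k c; rewrite is_projectionP// -/(a k) -colTheta.
  by split=> [/(can_inj (mulKmx Eunit))|->].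
- by apply/galerkin_eigenP => // k; rewrite -/E colTheta.
move=> m T d; split.
  rewrite galerkin_eigenP//; split=> eqT k.
    by rewrite lincomb_step integral_equation_step.
  by have := eqT k; rewrite lincomb_step integral_equation_step.
move=> /galerkin_eigenP eqT k dk.
have Wsym : (weight_mx A)^T = weight_mx A by rewrite tr_diag_mx.
have [c [gE cE]] := eigenvector_decomposition Wsym
  (kernel_mx_schmidt graphA phint expand) eigen_a dk (eqT graphA basis_vertex k).
exists c; split=> //.
rewrite -[LHS](mulKmx Eunit) gE /Theta -mulmxA; congr (_ *m _).
apply/colP => x; rewrite summxE !mxE; apply: eq_bigr => i _.
by rewrite !mxE mulrC.
Qed.
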